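(* If an $R_3$-like Finsler manifold $(M,L)$ is of scalar curvature, then it is of $s$-$ps$ curvature.
   Context: Setting. $M$ is a smooth manifold of finite dimension $n$, $\pi:\mathcal{T}M\to M$ is the bundle of nonzero tangent vectors, $\pi^{-1}(TM)\to\mathcal{T}M$ is the pullback of $TM$ by $\pi$, and $\mathfrak{X}(\pi(M))$ is the module of its smooth sections ($\pi$-vector fields, written $\overline{X}$). $\overline{\eta}(u)=(u,u)$ is the fundamental $\pi$-vector field. $\rho:T(\mathcal{T}M)\to\pi^{-1}(TM)$ is $\rho=(\pi_{\mathcal{T}M},d\pi)$ and $\gamma:\pi^{-1}(TM)\to V(\mathcal{T}M)$ is the natural isomorphism (vertical lift) onto the vertical bundle. $(M,L)$ is a Finsler manifold ($L$ positively homogeneous of degree $1$, smooth on $\mathcal{T}M$, with positive definite metric $g$ on $\pi^{-1}(TM)$ of components $g_{ij}=\frac12\partial^2L^2/\partial y^i\partial y^j$). Put $\ell(\overline{X})=L^{-1}g(\overline{X},\overline{\eta})$, $\hbar=g-\ell\otimes\ell$ and $\phi(\overline{X})=\overline{X}-L^{-1}\ell(\overline{X})\overline{\eta}$. A linear connection $\nabla$ in $\pi^{-1}(TM)$ is regular if, with $K(X)=\nabla_X\overline{\eta}$ and $H(\mathcal{T}M)=\ker K$, one has $T(\mathcal{T}M)=V(\mathcal{T}M)\oplus H(\mathcal{T}M)$; then $\beta=(\rho|_{H(\mathcal{T}M)})^{-1}$. Its torsion is $\mathbf{T}(X,Y)=\nabla_X\rho Y-\nabla_Y\rho X-\rho[X,Y]$;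 put $Q(\overline{X},\overline{Y})=\mathbf{T}(\beta\overline{X},\beta\overline{Y})$ and $T(\overline{X},\overline{Y})=\mathbf{T}(\gamma\overline{X},\beta\overline{Y})$. Throughout, $\nabla$ is the Cartan connection: the unique regular connection with $\nabla g=0$, $Q=0$ and $g(T(\overline{X},\overline{Y}),\overline{Z})=g(T(\overline{X},\overline{Z}),\overline{Y})$. Its classical curvature is $\mathbf{K}(X,Y)\rho Z=-\nabla_X\nabla_Y\rho Z+\nabla_Y\nabla_X\rho Z+\nabla_{[X,Y]}\rho Z$ and its $h$-curvature tensor is $R(\overline{X},\overline{Y})\overline{Z}=\mathbf{K}(\beta\overline{X},\beta\overline{Y})\overline{Z}$, with $R(\overline{X},\overline{Y},\overline{Z},\overline{W})=g(R(\overline{X},\overline{Y})\overline{Z},\overline{W})$. Put $Ric^h(\overline{X},\overline{Y})=\mathrm{Tr}\{\overline{Z}\mapsto R(\overline{X},\overline{Z})\overline{Y}\}$, $g(Ric^h_0(\overline{X}),\overline{Y})=Ric^h(\overline{X},\overline{Y})$, $Sc^h=\mathrm{Tr}(Ric^h_0)$, and $F=\frac{1}{n-2}\{Ric^h-\frac{Sc^h\,g}{2(n-1)}\}$. Definitions. $(M,L)$ is: - $R_3$-like if $\dim M\ge4$ and $R(\overline{X},\overline{Y},\overline{Z},\overline{W})=g(\overline{X},\overline{Z})F(\overline{Y},\overline{W})-g(\overline{Y},\overline{Z})F(\overline{X},\overline{W})+g(\overline{Y},\overline{W})F(\overline{X},\overline{Z})-g(\overline{X},\overline{W})F(\overline{Y},\overline{Z})$;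 - of scalar curvature ($\dim M\geq 3$) if $R(\overline{\eta},\overline{X},\overline{\eta},\overline{Y})=kL^2\hbar(\overline{X},\overline{Y})$ for some scalar function $k:\mathcal{T}M\to\mathbb{R}$; - of $p$-scalar (perpendicular scalar) curvature if there is a function $R_o$ with $R(\phi(\overline{X}),\phi(\overline{Y}),\phi(\overline{Z}),\phi(\overline{W}))=R_o\{\hbar(\overline{X},\overline{Z})\hbar(\overline{Y},\overline{W})-\hbar(\overline{X},\overline{W})\hbar(\overline{Y},\overline{Z})\}$; - of $s$-$ps$ curvature if it is both of scalar curvature and of $p$-scalar curvature. *)

(* Defs.v *)
From HB Require Import structures.
From mathcomp Require Import all_boot all_order all_algebra.
From mathcomp Require Import all_classical all_reals all_analysis.
Set Implicit Arguments.
Unset Strict Implicit.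
Unset Printing Implicit Defensive.
Import Order.TTheory GRing.Theory Num.Theory.
Import numFieldNormedType.Exports.
Local Open Scope classical_set_scope.
Local Open Scope ring_scope.

(* General convention: partially defined maps (charts, fields on the slit
   tangent bundle, ...) are total functions, and every condition on them is
   imposed on the relevant domain only. *)

(* [f] is of class C^oo on the open set [U] iff every iterated directional
   derivative of [f], of any order, is Frechet differentiable on [U]. *)
Definition smooth_on (R : realType) (V W : normedModType R) (U : set V)
    (f : V -> W) : Prop :=
  forall (s : seq V) (x : V), U x ->
    differentiable (foldr (fun v h => 'D_v h) f s) x.

(* The charts are [achart i : adom i -> 'rV_n], with local inverses [ainv i];
   [achart_at p] selects a chart around [p]. *)
Record atlas (R : realType) (n : nat) (T : Type) := Atlas {
  aidx : Type;
  adom : aidx -> set T;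
  achart : aidx -> T -> 'rV[R]_n;
  ainv : aidx -> 'rV[R]_n -> T;
  achart_at : T -> aidx
}.

Section Atlas.
Context (R : realType) (n : nat) (T : Type) (A : atlas R n T).

Definition atrans (i j : aidx A) : 'rV[R]_n -> 'rV[R]_n :=
  achart j \o ainv i.

(* A pair (point, vector), the vector being given by its components in all the
   charts; the components in a chart not containing the point are 0. *)
Definition tpt : Type := (T * (aidx A -> 'rV[R]_n))%type.

(* The tangent bundle: the components of a tangent vector in two charts are
   exchanged by the derivative of the change of coordinates. *)
Definition tangent : set tpt := [set u |
  (forall i, ~ adom i u.1 -> u.2 i = 0) /\
  (forall i j, adom i u.1 -> adom j u.1 ->
     u.2 j = 'D_(u.2 i) (atrans i j) (achart i u.1))].

(* The derivative w(f) of a function f along a tangent vector w at p. *)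
Definition vder (p : T) (w : aidx A -> 'rV[R]_n) (f : T -> R) : R :=
  let i := achart_at A p in 'D_(w i) (f \o ainv i) (achart i p).

Definition smooth_fun (W : normedModType R) (f : T -> W) : Prop :=
  forall i, smooth_on (achart i @` adom (a := A) i) (f \o ainv i).

End Atlas.
Arguments tangent {R n T} A.
Arguments tpt {R n T} A.

Definition smooth_manifold (R : realType) (n : nat) (M : topologicalType)
    (A : atlas R n M) : Prop :=
  [/\ hausdorff_space M /\ @second_countable M,
      forall p, adom (achart_at A p) p,
      forall i, open (adom (a := A) i) /\
        open (achart i @` adom (a := A) i),
      forall i, [/\ {in adom (a := A) i, cancel (achart i) (ainv i)},
        {within adom (a := A) i, continuous (achart (a := A) i)} &
        {within achart i @` adom i, continuous (ainv (a := A) i)}] &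
      forall i j : aidx A,
        smooth_on (achart i @` (adom i `&` adom j)) (atrans i j)].

Section Slit.
Context (R : realType) (n : nat) (M : Type) (A : atlas R n M).

(* The total space of the bundle of nonzero tangent vectors. *)
Definition slit : set (tpt A) := tangent A `\` [set u | u.2 = 0].

(* The tangent vector with coordinates z = (x, y) in the chart [i]. *)
Definition slit_inv (i : aidx A) (z : 'rV[R]_(n + n)) : tpt A :=
  let p := ainv i (lsubmx z) in
  (p, fun j => if `[< adom j p >]
               then 'D_(rsubmx z) (atrans i j) (lsubmx z) else 0).

(* The induced charts u |-> (x, y) of the slit tangent bundle. *)
Definition slit_atlas : atlas R (n + n) (tpt A) :=
  @Atlas R (n + n) (tpt A) (aidx A)
    (fun i => slit `&` [set u | adom i u.1])
    (fun i u => row_mx (achart i u.1) (u.2 i))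
    slit_inv
    (fun u => achart_at A u.1).

(* Components of vectors tangent to M, and to the slit tangent bundle. *)
Definition bvec : Type := aidx A -> 'rV[R]_n.
Definition tvec : Type := aidx A -> 'rV[R]_(n + n).

(* The fibre over u of the pullback bundle is the tangent space at the base
   point of u. *)
Definition pifield (X : tpt A -> bvec) : Prop :=
  (forall u, slit u -> tangent A (u.1, X u)) /\
  (forall i, smooth_on (achart (a := slit_atlas) i @` adom i)
               (fun z => X (slit_inv i z) i)).

Definition vfield (X : tpt A -> tvec) : Prop :=
  (forall u, slit u -> tangent slit_atlas (u, X u)) /\
  (forall i, smooth_on (achart (a := slit_atlas) i @` adom i)
               (fun z => X (slit_inv i z) i)).

Definition eta : tpt A -> bvec := fun u => u.2.

(* In the induced coordinates the projection is (x, y) |-> x, so that rho maps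
   the components (a, b) to a, and the vertical lift gamma maps a to (0, a). *)
Definition rho (w : tvec) : bvec := fun i => lsubmx (w i).
Definition gamma (a : bvec) : tvec := fun i => row_mx 0 (a i).

(* The Lie bracket, in coordinates X(Y^k) - Y(X^k). *)
Definition bracket (X Y : tpt A -> tvec) : tpt A -> tvec := fun u i =>
  if `[< adom i u.1 >] then
    let z := achart (a := slit_atlas) i u in
    'D_(X u i) (fun z' => Y (slit_inv i z') i) z
    - 'D_(Y u i) (fun z' => X (slit_inv i z') i) z
  else 0.

(* The trace at u of an endomorphism of the module of pi-vector fields,
   computed in a chart i at u on a family of pi-vector fields which takes at u
   the value of the coordinate frame. The value depends neither on the chart
   nor on the extensions. *)
Definition pitrace (Phi : (tpt A -> bvec) -> (tpt A -> bvec)) (u : tpt A) : R :=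
  xget 0 [set t | exists (i : aidx A) (E : 'I_n -> tpt A -> bvec),
    [/\ adom i u.1,
        forall k, pifield (E k),
        forall k, E k u i = delta_mx 0 k &
        t = \sum_(k < n) Phi (E k) u i 0 k]].

(* [D u w Y] is the covariant derivative of the pi-vector field Y along the
   vector w tangent at u to the slit tangent bundle. *)
Definition connection : Type :=
  tpt A -> tvec -> (tpt A -> bvec) -> bvec.

Definition cov (D : connection) (X : tpt A -> tvec) (Y : tpt A -> bvec) :
  tpt A -> bvec := fun u => D u (X u) Y.

Definition linear_connection (D : connection) : Prop :=
  [/\ forall X Y, vfield X -> pifield Y -> pifield (cov D X Y),
      forall u (a : R) w1 w2 Y, slit u ->
        tangent slit_atlas (u, w1) -> tangent slit_atlas (u, w2) ->
        pifield Y -> D u (a *: w1 + w2) Y = a *: D u w1 Y + D u w2 Y,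
      forall u w Y Z, slit u -> tangent slit_atlas (u, w) ->
        pifield Y -> pifield Z -> D u w (Y + Z) = D u w Y + D u w Z &
      forall u w (f : tpt A -> R) Y, slit u -> tangent slit_atlas (u, w) ->
        smooth_fun slit_atlas f -> pifield Y ->
        D u w (fun v => f v *: Y v)
        = vder (A := slit_atlas) u w f *: Y u + f u *: D u w Y].

Section Connection.
Variable D : connection.

Definition vertical (u : tpt A) : set tvec :=
  [set w | tangent slit_atlas (u, w) /\ rho w = 0].

(* The kernel of K : w |-> D_w eta. *)
Definition horizontal (u : tpt A) : set tvec :=
  [set w | tangent slit_atlas (u, w) /\ D u w eta = 0].

Definition regular : Prop := forall u, slit u ->
  (forall w, tangent slit_atlas (u, w) ->
     exists v h, [/\ vertical u v, horizontal u h & w = v + h]) /\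
  vertical u `&` horizontal u `<=` [set 0].

Definition beta (X : tpt A -> bvec) : tpt A -> tvec := fun u =>
  xget 0 [set w | horizontal u w /\ rho w = X u].

Definition vlift (X : tpt A -> bvec) : tpt A -> tvec := fun u => gamma (X u).
Definition rhof (X : tpt A -> tvec) : tpt A -> bvec := fun u => rho (X u).

Definition torsion (X Y : tpt A -> tvec) : tpt A -> bvec :=
  cov D X (rhof Y) - cov D Y (rhof X) - rhof (bracket X Y).

Definition Qtorsion (X Y : tpt A -> bvec) : tpt A -> bvec :=
  torsion (beta X) (beta Y).
Definition Ttorsion (X Y : tpt A -> bvec) : tpt A -> bvec :=
  torsion (vlift X) (beta Y).

(* The classical curvature K(X, Y)W, where W stands for rho Z. *)
Definition curvature (X Y : tpt A -> tvec) (W : tpt A -> bvec) :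
    tpt A -> bvec :=
  - cov D X (cov D Y W) + cov D Y (cov D X W) + cov D (bracket X Y) W.

Definition hcurv (X Y Z : tpt A -> bvec) : tpt A -> bvec :=
  curvature (beta X) (beta Y) Z.

End Connection.

Section Finsler.
Variable L : tpt A -> R.

Definition gcomp (u : tpt A) (i : aidx A) (j k : 'I_n) : R :=
  2^-1 * 'D_(row_mx 0 (delta_mx 0 j))
           ('D_(row_mx 0 (delta_mx 0 k)) (fun z => L (slit_inv i z) ^+ 2))
           (achart (a := slit_atlas) i u).

Definition gmet (u : tpt A) (a b : bvec) : R :=
  let i := achart_at A u.1 in
  \sum_(j < n) \sum_(k < n) gcomp u i j k * a i 0 j * b i 0 k.

Definition finsler : Prop :=
  [/\ forall p (v : bvec) (c : R), tangent A (p, v) -> 0 < c ->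
        L (p, c *: v) = c * L (p, v),
      smooth_fun slit_atlas L &
      forall u (a : bvec), slit u -> tangent A (u.1, a) -> a <> 0 ->
        0 < gmet u a a].

Definition gf (X Y : tpt A -> bvec) : tpt A -> R :=
  fun u => gmet u (X u) (Y u).

Definition ell (X : tpt A -> bvec) : tpt A -> R :=
  fun u => (L u)^-1 * gf X eta u.

Definition hbar (X Y : tpt A -> bvec) : tpt A -> R :=
  fun u => gf X Y u - ell X u * ell Y u.

Definition phi (X : tpt A -> bvec) : tpt A -> bvec :=
  fun u => X u - ((L u)^-1 * ell X u) *: eta u.

Definition cartan_connection (D : connection) : Prop :=
  [/\ linear_connection D, regular D,
      forall u w X Y, slit u -> tangent slit_atlas (u, w) ->
        pifield X -> pifield Y ->
        vder (A := slit_atlas) u w (gf X Y)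
        = gmet u (D u w X) (Y u) + gmet u (X u) (D u w Y),
      forall u X Y, slit u -> pifield X -> pifield Y ->
        Qtorsion D X Y u = 0 &
      forall u X Y Z, slit u -> pifield X -> pifield Y -> pifield Z ->
        gf (Ttorsion D X Y) Z u = gf (Ttorsion D X Z) Y u].

Variable D : connection.

Definition hcurv4 (X Y Z W : tpt A -> bvec) : tpt A -> R :=
  gf (hcurv D X Y Z) W.

Definition Rich (X Y : tpt A -> bvec) : tpt A -> R :=
  pitrace (fun Z => hcurv D X Z Y).

Definition Rich0 (X : tpt A -> bvec) : tpt A -> bvec :=
  xget 0 [set W | pifield W /\
    forall Y u, pifield Y -> slit u -> gf W Y u = Rich X Y u].

Definition Sch : tpt A -> R := pitrace Rich0.

Definition Ften (X Y : tpt A -> bvec) : tpt A -> R := fun u =>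
  (n%:R - 2)^-1 * (Rich X Y u - Sch u * gf X Y u / (2 * (n%:R - 1))).

Definition R3_like : Prop := (4 <= n)%N /\
  forall X Y Z W u, pifield X -> pifield Y -> pifield Z -> pifield W ->
    slit u ->
    hcurv4 X Y Z W u
    = gf X Z u * Ften Y W u - gf Y Z u * Ften X W u
      + gf Y W u * Ften X Z u - gf X W u * Ften Y Z u.

Definition scalar_curvature : Prop := (3 <= n)%N /\
  exists k : tpt A -> R, forall X Y u, pifield X -> pifield Y -> slit u ->
    hcurv4 eta X eta Y u = k u * L u ^+ 2 * hbar X Y u.

Definition p_scalar_curvature : Prop :=
  exists Ro : tpt A -> R, forall X Y Z W u,
    pifield X -> pifield Y -> pifield Z -> pifield W -> slit u ->
    hcurv4 (phi X) (phi Y) (phi Z) (phi W) u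
    = Ro u * (hbar X Z u * hbar Y W u - hbar X W u * hbar Y Z u).

Definition s_ps_curvature : Prop := scalar_curvature /\ p_scalar_curvature.

End Finsler.
End Slit.

(* Main.v *)
From HB Require Import structures.
Require Import Defs.
From mathcomp Require Import all_boot all_order all_algebra.
From mathcomp Require Import all_classical all_reals all_analysis.
From mathcomp Require Import ring.

(** The heart of the matter is pointwise algebra. Substituting
    [(eta, phi X, eta, phi Y)] in the [R3_like] formula, and using
    [g(eta, eta) = L^2] and [g(phi X, eta) = g(eta, phi X) = 0], leaves
    [L^2 F(phi X, phi Y) + hbar(X, Y) F(eta, eta)], because
    [g(phi X, phi Y) = hbar(phi X, phi Y) = hbar(X, Y)]. Scalar curvature makes
    this equal to [k L^2 hbar(X, Y)], so that on projected fields the tensor [F]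
    is a multiple of the angular metric:
    [F(phi X, phi Y) = (k - F(eta, eta) / L^2) hbar(X, Y)].
    Substituting this in the [R3_like] formula at four projected fields gives
    p-scalar curvature with [Ro = 2 (k - F(eta, eta) / L^2)].

    What remains is to justify the substitutions. The curvature hypotheses speak
    of smooth sections only, so [eta] and [phi X] have to be smooth sections
    ([eta_pifield], [phi_pifield]); and the orthogonality relations need
    [g(eta, a) = g(a, eta)]. The latter comes from Euler's theorem for the
    function [L^2], homogeneous of degree 2 on the fibres. Applied once to [L^2]
    and once to its vertical derivatives, it shows that [g(a, eta)] and
    [g(eta, a)] are both half the vertical derivative of [L^2] along [a]
    ([gmet_etar], [gmet_etal]), and hence equal. This expression also gives the
    smoothness of [phi X]. The metric at [u] is defined in a chart chosen by
    [u], possibly discontinuously; but a vertical derivative is the same in all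
    charts ([derive_vert_chart]), so in any chart the coefficient of [eta] in
    [phi X] is a polynomial expression in smooth functions: [1 / L], the
    components of [X], and the partial derivatives of [L^2]. *)

Set Implicit Arguments.
Unset Strict Implicit.
Unset Printing Implicit Defensive.
Import Order.TTheory GRing.Theory Num.Theory.
Import numFieldNormedType.Exports.
Local Open Scope classical_set_scope.
Local Open Scope ring_scope.

(** * Smooth functions on an open set *)

Section SmoothCalculus.
Context (R : realType) (V : normedModType R).
Implicit Types (W : normedModType R) (U : set V).

(** [smooth_on] quantifies over lists of directions, read from the inside; this
    recursive form peels off the innermost derivative instead, which is what an
    induction along the Leibniz rule consumes. Its index [k] stands for [k + 1]
    successive differentiations. *)
Fixpoint Ck k W U (f : V -> W) : Prop :=
  (forall x, U x -> differentiable f x) /\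
  (if k is k'.+1 then forall v, Ck k' U ('D_v f) else True).

Lemma smooth_onP W U (f : V -> W) : smooth_on U f <-> forall k, Ck k U f.
Proof.
split=> [sf k | Cf s x Ux].
  elim: k f sf => [|k IHk] f sf;
    (split; first by move=> x Ux; have := sf [::] x Ux) => // v.
  by apply: IHk => s x Ux; have := sf (rcons s v) x Ux; rewrite foldr_rcons.
have {Cf} := Cf (size s); elim/last_ind: s f => [|s v IHs] f.
  by case=> df _; apply: df.
by rewrite size_rcons foldr_rcons => -[_ Df]; apply: (IHs _ (Df v)).
Qed.

Lemma CkW k W U (f : V -> W) : Ck k.+1 U f -> Ck k U f.
Proof.
elim: k f => [|k IHk] f [df Df]; split=> // v.
by apply: IHk; apply: Df.
Qed.

Lemma derive_eq_on W U (f g : V -> W) v x : open U -> U x ->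
  (forall y, U y -> f y = g y) -> 'D_v f x = 'D_v g x.
Proof.
move=> oU Ux fg; have [->|v0] := eqVneq v 0; first by rewrite !derive0.
apply: near_eq_derive => //.
by apply: filterS (open_nbhs_nbhs (conj oU Ux)) => y; apply: fg.
Qed.

(** The differential of [f] is also one of [g], as the little-o condition only
    looks near [x]. *)
Lemma near_eq_diff W (f g : V -> W) x : (\near x, f x = g x) ->
  differentiable f x -> differentiable g x.
Proof.
move=> fg df; have fgx := nbhs_singleton fg.
have gE : g \o shift x = cst (g x) + 'd f x +o_ 0 id.
  have /eqaddoP ef := diff_locally df.
  apply/eqaddoP => e e0; have := ef e e0.
  have : \forall h \near 0, f (h + x) = g (h + x).
    move: fg; rewrite (near_shift 0) /= => fg.
    by near=> h => /=; rewrite -[x in h + x]subr0; near: h.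
  apply: filterS2 => h /= fgh.
  suff -> : (f \o shift x - (cst (f x) + 'd f x)) h
         = (g \o shift x - (cst (g x) + 'd f x)) h by [].
  by rewrite -fgx; congr (_ - _).
apply/diff_locallyP; split.
  by rewrite (diff_unique (diff_continuous df) gE); exact: diff_continuous.
by rewrite (diff_unique (diff_continuous df) gE).
Unshelve. all: by end_near. Qed.

Lemma diff_eq_on W U (f g : V -> W) x : open U -> U x ->
  (forall y, U y -> f y = g y) -> differentiable f x -> differentiable g x.
Proof.
move=> oU Ux fg; apply: near_eq_diff.
by apply: filterS (open_nbhs_nbhs (conj oU Ux)) => y; apply: fg.
Qed.

Lemma eq_Ck k W U (f g : V -> W) : open U ->
  (forall y, U y -> f y = g y) -> Ck k U f -> Ck k U g.
Proof.
move=> oU; elim: k f g => [|k IHk] f g fg [df Df];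
  (split; first by move=> x Ux;
     apply: (diff_eq_on oU Ux fg); apply: df) => // v.
by apply: IHk (Df v) => y Uy; apply: derive_eq_on oU Uy _.
Qed.

Lemma Ck_cst k W U (c : W) : Ck k U (cst c).
Proof.
elim: k c => [|k IHk] c;
  (split; first by move=> x _; exact: differentiable_cst) => // v.
by rewrite (_ : 'D_v (cst c) = cst 0) //; apply/funext => x; rewrite derive_cst.
Qed.

Lemma CkD k W U (f g : V -> W) : open U ->
  Ck k U f -> Ck k U g -> Ck k U (f + g).
Proof.
move=> oU; elim: k f g => [|k IHk] f g [df Df] [dg Dg];
  (split; first by move=> x Ux;
     apply: differentiableD; [apply: df|apply: dg]) => // v.
apply: (@eq_Ck k W U ('D_v f + 'D_v g)) => // [y Uy|];
  last exact: IHk (Df v) (Dg v).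
by rewrite deriveD //; apply: diff_derivable; [apply: df|apply: dg].
Qed.

Lemma Ck_sum k W U m (f : 'I_m -> V -> W) : open U ->
  (forall i, Ck k U (f i)) -> Ck k U (\sum_(i < m) f i).
Proof.
move=> oU Cf; apply: (big_ind (Ck k U)) => [|g h Cg Ch|i _]; last exact: Cf.
  exact: Ck_cst.
exact: CkD.
Qed.

Lemma CkM k U (f g : V -> R) : open U -> Ck k U f -> Ck k U g -> Ck k U (f * g).
Proof.
move=> oU; elim: k f g => [|k IHk] f g Cf Cg;
  have [df Df] := Cf; have [dg Dg] := Cg;
  (split; first by move=> x Ux;
     apply: differentiableM; [apply: df|apply: dg]) => // v.
apply: (@eq_Ck k _ U (f * 'D_v g + g * 'D_v f)) => // [y Uy|].
  by rewrite deriveM //; apply: diff_derivable; [apply: df|apply: dg].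
by apply: CkD => //; apply: IHk; try exact: CkW; [exact: (Dg v)|exact: (Df v)].
Qed.

Lemma CkN k U (f : V -> R) : open U -> Ck k U f -> Ck k U (- f).
Proof.
move=> oU Cf; rewrite (_ : - f = cst (-1) * f).
  by apply: CkM => //; exact: Ck_cst.
by apply/funext => x; rewrite /= mulN1r.
Qed.

Lemma CkV k U (f : V -> R) : open U -> (forall x, U x -> f x != 0) ->
  Ck k U f -> Ck k U (fun x => (f x)^-1).
Proof.
move=> oU f0; elim: k f f0 => [|k IHk] f f0 Cf; have [df Df] := Cf;
  (split; first by move=> x Ux;
     apply: differentiableV; [apply: df|apply: f0]) => // v.
pose fV := fun x => (f x)^-1.
apply: (@eq_Ck k _ U (- (fV * fV * 'D_v f))) => // [y Uy|].
  rewrite deriveV ?f0//; last by apply: diff_derivable; apply: df.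
  by rewrite scaleNr expr2 invfM.
apply: CkN => //; apply: CkM => //; last exact: (Df v).
by apply: CkM => //; apply: IHk f0 (CkW Cf).
Qed.

(** The derivative of [l \o f] along [v] is [l] applied to that of [f], so that
    the class of such compositions is stable under derivation. *)
Lemma Ck_linear k W W' U (l : W -> W') (f : V -> W) : open U ->
  linear l -> continuous l -> Ck k U f -> Ck k U (l \o f).
Proof.
move=> oU ll cl.
pose lL : {linear W -> W'} := HB.pack l (GRing.isLinear.Build _ _ _ _ _ ll).
have dl y : differentiable l y by exact: (@linear_differentiable _ _ _ lL).
elim: k f => [|k IHk] f [df Df];
  (split; first by move=> x Ux;
     apply: differentiable_comp => //; apply: df) => // v.
apply: (@eq_Ck k _ U (l \o 'D_v f)) => // [y Uy|]; last exact: IHk (Df v).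
rewrite [RHS]deriveE; last by apply: differentiable_comp => //; exact: df.
rewrite diff_comp //; last exact: df.
by rewrite (@diff_lin _ _ _ lL) //= deriveE //; apply: df.
Qed.

Lemma Ck_id k U : Ck k U (@id V).
Proof.
case: k => [|k]; (split; first by move=> x _; apply: ex_diff) => // v.
rewrite (_ : 'D_v id = cst v); first exact: Ck_cst.
by apply/funext => x; rewrite derive_id.
Qed.

Lemma Ck_coord k n U (f : V -> 'rV[R]_n) j : open U -> Ck k U f ->
  Ck k U (fun x => f x 0 j).
Proof.
move=> oU; apply: (Ck_linear (l := fun w : 'rV[R]_n => w 0 j)) => //.
  by move=> a u v; rewrite !mxE.
exact: coord_continuous.
Qed.

Lemma CkZ k n U (f : V -> R) (X : V -> 'rV[R]_n) : open U ->
  Ck k U f -> Ck k U X -> Ck k U (fun x => f x *: X x).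
Proof.
move=> oU Cf CX.
(* Coordinatewise, scaling is multiplication followed by a linear map. *)
apply: (@eq_Ck k _ U (\sum_(j < n)
  (( *:%R^~ (delta_mx 0 j : 'rV[R]_n)) \o (f * (fun x => X x 0 j)))))
  => // [x _|].
  rewrite fct_sumE [in RHS](row_sum_delta (X x)) scaler_sumr.
  by apply: eq_bigr => j _; rewrite /= scalerA.
apply: Ck_sum => // j; apply: Ck_linear => //.
- by move=> a u v /=; rewrite scalerDl scalerA.
- exact: scalel_continuous.
by apply: CkM => //; apply: Ck_coord.
Qed.

Lemma derive_line W (f : V -> W) (a v : V) :
  'D_v f a = 'D_1 (fun t : R => f (t *: v + a)) 0.
Proof.
rewrite /derive; congr (lim _); apply: (congr1 (fun g => g @ (0 : R)^')).
by apply/funext => t /=; rewrite scale0r add0r addr0 [t *: 1]mulr1.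
Qed.

End SmoothCalculus.

(** * Charts of the slit tangent bundle *)

Section Charts.
Context (R : realType) (n : nat) (M : topologicalType) (A : atlas R n M).
Context (mfdM : smooth_manifold A).
Implicit Types (i j k : aidx A) (p : M) (u : tpt A).

Lemma chartK i p : adom i p -> ainv i (achart i p) = p.
Proof.
by case: mfdM => _ _ _ cK _ ip; case: (cK i) => + _ _; apply; rewrite inE.
Qed.

Lemma atrans_diff i j p : adom i p -> adom j p ->
  differentiable (atrans i j) (achart i p).
Proof.
by case: mfdM => _ _ _ _ ts ip jp; apply: (ts i j [::]); exists p.
Qed.

Lemma atransE i j p : adom i p -> atrans i j (achart i p) = achart j p.
Proof. by move=> ip; rewrite /atrans /= chartK. Qed.

(** Since [ainv i] is continuous on the open image of the chart, whatever is
    computed in two charts at [p] can be computed in both near [p]. *)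
Lemma near_chart i j p : adom i p -> adom j p ->
  \forall x \near achart i p,
    [/\ adom i (ainv i x), adom j (ainv i x) & achart i (ainv i x) = x].
Proof.
case: mfdM => _ _ od cK _ ip jp.
have [oi oUi] := od i; have [oj _] := od j; have [_ _ ci] := cK i.
have Up : (achart i @` adom i) (achart i p) by exists p.
have {}ci : {for achart i p, continuous (ainv i)}.
  by move: ci; rewrite continuous_open_subspace //; apply; rewrite inE.
have jn : \forall x \near achart i p, adom j (ainv i x).
  by apply: ci; rewrite chartK //; apply: open_nbhs_nbhs.
have un : \forall x \near achart i p, (achart i @` adom i) x.
  exact: open_nbhs_nbhs.
by apply: filterS2 jn un => x jx [q iq qx]; rewrite -qx chartK // in jx *.
Qed.

Lemma derive_atrans_id i p v : adom i p -> 'D_v (atrans i i) (achart i p) = v.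
Proof.
move=> ip; rewrite (@near_eq_derive _ _ _ _ id) ?derive_id //.
by apply: filterS (near_chart ip ip) => x [].
Qed.

(** The cocycle rule for the derivatives of the changes of coordinates; it makes
    the components given by [slit_inv] those of a tangent vector. *)
Lemma derive_atrans_comp i j k p v : adom i p -> adom j p -> adom k p ->
  'D_v (atrans i k) (achart i p)
  = 'D_('D_v (atrans i j) (achart i p)) (atrans j k) (achart j p).
Proof.
move=> ip jp kp; rewrite (@near_eq_derive _ _ _ _ (atrans j k \o atrans i j)).
  have dij := atrans_diff ip jp; have djk := atrans_diff jp kp.
  have djk' : differentiable (atrans j k) (atrans i j (achart i p)).
    by rewrite atransE.
  rewrite (deriveE v (differentiable_comp dij djk')) (diff_comp dij djk').
  by rewrite /= (atransE j ip) [RHS](deriveE _ djk) (deriveE v dij).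
apply: filterS (near_chart ip jp) => x [ix jx xE].
by rewrite /atrans /= chartK.
Qed.

(** The derivative of a change of coordinates depends linearly on the direction,
    so the tangent vectors at [p] form a vector space. *)
Lemma tangent_comb p (a b : bvec A) (c : R) :
  tangent A (p, a) -> tangent A (p, b) -> tangent A (p, c *: a + b).
Proof.
move=> [/= a0 at_] [/= b0 bt]; split=> /= [i ip|i j ip jp].
  by rewrite (_ : (c *: a + b) i = c *: a i + b i) // a0 // b0 // scaler0 addr0.
have d := atrans_diff ip jp.
have -> : (c *: a + b) j = c *: a j + b j by [].
by rewrite (at_ i) // (bt i) //= !deriveE // -linearP.
Qed.

Lemma tangent0 p : tangent A (p, 0).
Proof. by split=> // i j _ _ /=; rewrite derive0. Qed.

Lemma tangentZ p (a : bvec A) (c : R) :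
  tangent A (p, a) -> tangent A (p, c *: a).
Proof.
by move=> ta; rewrite -[c *: a]addr0; apply: tangent_comb (tangent0 p).
Qed.

Definition tcoord i u : 'rV[R]_(n + n) := row_mx (achart i u.1) (u.2 i).

Lemma slit_invK i u : tangent A u -> adom i u.1 -> slit_inv i (tcoord i u) = u.
Proof.
case: u => p w [/= w0 wt] ip; rewrite /slit_inv row_mxKl row_mxKr chartK //=.
congr (_, _); apply/funext => j; case: asboolP => jp; last by rewrite w0.
by rewrite (wt i j).
Qed.

Lemma slit_inv_tangent i p y : adom i p ->
  tangent A (slit_inv i (row_mx (achart i p) y)).
Proof.
move=> ip; rewrite /slit_inv row_mxKl row_mxKr chartK //.
split=> /= [j jp|j k jp kp].
  by case: asboolP.
case: asboolP => [_|/(_ kp) []]; case: asboolP => [_|/(_ jp) []].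
exact: derive_atrans_comp.
Qed.

Lemma slit_inv_comp i p y : adom i p ->
  (slit_inv (A := A) i (row_mx (achart i p) y)).2 i = y.
Proof.
move=> ip; rewrite /slit_inv row_mxKl row_mxKr chartK //=.
by case: asboolP => // _; rewrite derive_atrans_id.
Qed.

Lemma tangent_eq0 i u : tangent A u -> adom i u.1 -> u.2 i = 0 -> u.2 = 0.
Proof.
case: u => p w [/= w0 wt] ip wi; apply/funext => j.
have [jp|jp] := pselect (adom j p); last exact: w0.
by rewrite (wt i j) //= wi derive0.
Qed.

Definition slit_dom i : set 'rV[R]_(n + n) :=
  achart (a := slit_atlas A) i @` adom (a := slit_atlas A) i.

(** Read in this way, [slit_dom] is open, so that derivatives at its points
    depend only on values in it. *)
Lemma slit_domP i z : slit_dom i z <->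
  exists p y, [/\ adom i p, y != 0 & z = row_mx (achart i p) y].
Proof.
split=> [[u [[tu u0] iu] <-]|[p [y [ip y0 ->]]]].
  exists u.1, (u.2 i); split=> //; apply/eqP => ui.
  by apply: u0; apply: tangent_eq0 ui.
have ip' : adom i (slit_inv i (row_mx (achart i p) y)).1.
  by rewrite /= row_mxKl chartK.
exists (slit_inv i (row_mx (achart i p) y)).
  split=> //; split; first exact: slit_inv_tangent.
  move=> u0; move/eqP: y0; apply; rewrite -(@slit_inv_comp i p y ip).
  by move: u0; rewrite /mkset => ->.
rewrite [LHS]/= -[in RHS](@slit_inv_comp i p y ip); congr row_mx.
by rewrite row_mxKl chartK.
Qed.

Lemma open_slit_dom i : open (slit_dom i).
Proof.
have -> : slit_dom i = lsubmx @^-1` (achart i @` adom i)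
                     `&` rsubmx @^-1` [set y | y != 0].
  apply/seteqP; split=> [z /slit_domP[p [y [ip y0 ->]]]|z [[p ip pz] z0]].
    by split=> /=; rewrite ?row_mxKl ?row_mxKr //; exists p.
  by apply/slit_domP; exists p, (rsubmx z); split=> //; rewrite pz hsubmxK.
case: mfdM => _ _ od _ _; have [_ oU] := od i.
apply: openI; apply: open_comp => //.
- by move=> x _; exact: continuous_lsubmx.
- by move=> x _; exact: continuous_rsubmx.
rewrite (_ : [set y | y != 0] = ~` [set 0]).
  apply/closed_openC/accessible_closed_set1.
  exact/hausdorff_accessible/norm_hausdorff.
by apply/seteqP; split=> y /eqP.
Qed.

Lemma slit_inv_slit i z : slit_dom i z ->
  [/\ slit (slit_inv i z), adom i (slit_inv i z).1
    & tcoord i (slit_inv i z) = z].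
Proof.
case=> u [[tu u0] iu] <-; rewrite /= -/(tcoord i u) slit_invK //; split=> //.
by rewrite row_mxKl chartK.
Qed.

Lemma slit_dom_coord i u : slit u -> adom i u.1 -> slit_dom i (tcoord i u).
Proof. by move=> su iu; exists u. Qed.

(** The right-hand side does not mention [i]: this is the source of the chart
    independence of vertical derivatives. *)
Lemma slit_inv_vert i u (a : bvec A) (t : R) : slit u -> tangent A (u.1, a) ->
  adom i u.1 ->
  slit_inv i (t *: row_mx 0 (a i) + tcoord i u) = (u.1, t *: a + u.2).
Proof.
move=> [tu _] ta iu; rewrite scale_row_mx scaler0 add_row_mx add0r.
have tw : tangent A (u.1, t *: a + u.2).
  by apply: tangent_comb ta _; case: (u) tu.
exact: (slit_invK (u := (u.1, t *: a + u.2)) tw iu).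
Qed.

(** The two difference quotients are already equal, since both coordinate lines
    describe the same line of the fibre. *)
Lemma derive_vert_chart (W : normedModType R) i j u (a : bvec A)
    (f : tpt A -> W) :
  slit u -> tangent A (u.1, a) -> adom i u.1 -> adom j u.1 ->
  'D_(row_mx 0 (a i)) (f \o slit_inv i) (tcoord i u)
  = 'D_(row_mx 0 (a j)) (f \o slit_inv j) (tcoord j u).
Proof.
move=> su ta iu ju; rewrite [LHS]derive_line [RHS]derive_line.
apply: (congr1 (fun g : R -> W => 'D_1 g 0)); apply/funext => t /=.
by rewrite (slit_inv_vert t su ta iu) (slit_inv_vert t su ta ju).
Qed.

Lemma eta_pifield : pifield (@eta R n M A).
Proof.
split=> [u [tu _]|i]; first by case: u tu.
have oU := @open_slit_dom i.
apply/smooth_onP => k.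
apply: (@eq_Ck _ _ _ _ _ (rsubmx \o id)) => // [z|].
  move=> /slit_domP[p [y [ip y0 ->]]].
  by rewrite /eta slit_inv_comp //= row_mxKr.
apply: Ck_linear => //; last exact: Ck_id.
  by move=> c v w; apply/rowP => j; rewrite !mxE.
exact: continuous_rsubmx.
Qed.

End Charts.

(** * Euler's theorem on the fibres *)

Section Euler.
Context (R : realType) (n : nat).
Implicit Types (x y w : 'rV[R]_n) (h : 'rV[R]_(n + n) -> R).

(** Homogeneity on a single ray rather than on the whole fibre: for a function
    smooth off the zero section, the homogeneity of the derivatives holds only
    there. *)
Definition ray_homogeneous (m : nat) h x y :=
  forall c : R, 0 < c -> h (row_mx x (c *: y)) = c ^+ m * h (row_mx x y).

(** Euler's theorem: on the ray of [y], the function [h] is [(t + 1)^m h(x, y)]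
    at the point [(x, y + t y)]. *)
Lemma euler m h x y : ray_homogeneous m h x y ->
  'D_(row_mx 0 y) h (row_mx x y) = m%:R * h (row_mx x y).
Proof.
move=> hh; rewrite derive_line.
pose s : R -> R := id + cst 1; pose K := h (row_mx x y).
rewrite (@near_eq_derive _ _ _ _ (K \*: s ^+ m)).
  have di : derivable (id : R -> R) 0 1 by exact: derivable_id.
  have dc : derivable (cst 1 : R -> R) 0 1 by exact: derivable_cst.
  have ds : derivable s 0 1 := derivableD di dc.
  rewrite deriveZ; last exact: derivableX.
  rewrite (deriveX m ds) (deriveD di dc) derive_id derive_cst.
  by rewrite /s /cst /= !fctE add0r expr1n addr0 mulr1 [_ *: 1]mulr1 [LHS]mulrC.
have : \forall t \near (0 : R), 0 < t + 1.
  have : (fun t : R => t + 1) @ (0 : R) --> (0 + 1 : R).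
    by apply: cvgD; [exact: cvg_id|exact: cvg_cst].
  by move=> /cvgr_gt; apply; rewrite add0r.
apply: filterS => t t0.
rewrite scale_row_mx scaler0 add_row_mx add0r.
rewrite -[X in _ + X]scale1r -scalerDl hh //.
by rewrite -[RHS]/(K * (s ^+ m) t) exprfctE mulrC.
Qed.

(** A derivative of a homogeneous function is homogeneous of one degree less:
    the increments of [h] at [(x, c y)] along [c w] are those at [(x, y)] along
    [w], multiplied by [c ^+ m.+1]. *)
Lemma homogeneous_derive m h x y w (c : R) :
  (forall y', ray_homogeneous m.+1 h x y') -> 0 < c ->
  differentiable h (row_mx x (c *: y)) ->
  derivable h (row_mx x y) (row_mx 0 w) ->
  'D_(row_mx 0 w) h (row_mx x (c *: y))
  = c ^+ m * 'D_(row_mx 0 w) h (row_mx x y).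
Proof.
move=> hh c0 dh dhw; set z := row_mx x y; set v := row_mx 0 w.
have E : 'D_(c *: v) h (row_mx x (c *: y)) = 'D_v (c ^+ m.+1 \*o h) z.
  rewrite [LHS]derive_line [RHS]derive_line.
  apply: (congr1 (fun f : R -> R => 'D_1 f 0)); apply/funext => t /=.
  rewrite /v /z !scale_row_mx !scaler0 !add_row_mx !add0r.
  by rewrite scalerA mulrC -scalerA -scalerDr hh.
apply: (mulfI (lt0r_neq0 c0)).
rewrite mulrA -exprS -[RHS]deriveMl // -E !deriveE //.
by rewrite linearZ.
Qed.

Lemma derive_row_sum h z w : differentiable h z ->
  'D_(row_mx 0 w) h z = \sum_(k < n) w 0 k * 'D_(row_mx 0 (delta_mx 0 k)) h z.
Proof.
move=> dh; rewrite deriveE // [w in LHS]row_sum_delta.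
have -> : row_mx 0 (\sum_j w 0 j *: delta_mx 0 j)
  = \sum_j w 0 j *: row_mx 0 (delta_mx 0 j) :> 'rV[R]_(n + n).
  rewrite -[RHS]hsubmxK !linear_sum /=; congr row_mx.
    by rewrite big1 // => j _; rewrite linearZ /= row_mxKl scaler0.
  by apply: eq_bigr => j _; rewrite linearZ /= row_mxKr.
by rewrite linear_sum; apply: eq_bigr => k _; rewrite linearZ -deriveE.
Qed.

(** Differentiating Euler's relation [sum_k y_k D_k h = 2 h] along [w] gives
    [D_w h + sum_k y_k D_w D_k h = 2 D_w h]. *)
Lemma hessian_euler_r (U : set 'rV[R]_(n + n)) h x y w : open U ->
  Ck 1 U h -> U (row_mx x y) ->
  (forall z, U z -> ray_homogeneous 2 h (lsubmx z) (rsubmx z)) ->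
  \sum_(k < n) y 0 k *
     'D_(row_mx 0 w) ('D_(row_mx 0 (delta_mx 0 k)) h) (row_mx x y)
  = 'D_(row_mx 0 w) h (row_mx x y).
Proof.
move=> oU [dh Dh] Uxy hh; set z := row_mx x y.
pose e k : 'rV[R]_(n + n) := row_mx 0 (delta_mx 0 k).
(* The coordinate [y_k] as a function on the chart domain. *)
pose c (k : 'I_n) (z : 'rV[R]_(n + n)) := rsubmx z 0 k.
have cz k : c k z = y 0 k by rewrite /c row_mxKr.
have dDh k : differentiable ('D_(e k) h) z.
  by have [D1 _] := Dh (e k); apply: D1.
have dc k : differentiable (c k) z.
  apply: (@differentiable_comp _ _ _ _ rsubmx (fun v : 'rV[R]_n => v 0 k)).
    exact: differentiable_rsubmx.
  exact: differentiable_coord.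
have Dc k : 'D_(row_mx 0 w) (c k) z = w 0 k.
  rewrite /derive; apply: lim_near_cst => //.
  near=> t; rewrite /= /c /z scale_row_mx add_row_mx !row_mxKr !mxE addrK.
  by rewrite [LHS]mulKf //; near: t; exact: nbhs_dnbhs_neq.
have : 'D_(row_mx 0 w) (\sum_(k < n) c k * 'D_(e k) h) z
     = 'D_(row_mx 0 w) (2 \*o h) z.
  apply: (derive_eq_on _ oU Uxy) => v Uv.
  rewrite fct_sumE -[RHS]/(2 * h v) -[v in RHS]hsubmxK -(euler (hh _ Uv)).
  by rewrite derive_row_sum hsubmxK //; apply: dh.
rewrite deriveMl; last by apply: diff_derivable; exact: dh.
rewrite derive_sum; last by move=> k; apply: derivableM; exact: diff_derivable.
under eq_bigr => k _.
  rewrite deriveM; [|exact: diff_derivable|exact: diff_derivable].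
  rewrite Dc cz /GRing.scale /= [_ * w 0 k]mulrC; over.
rewrite big_split /= -derive_row_sum; last exact: dh.
by move=> H; apply: (addIr ('D_(row_mx 0 w) h z)); rewrite H mulr_natl mulr2n.
Unshelve. all: by end_near. Qed.

(** Here Euler's theorem applies to each [D_k h], homogeneous of degree 1. *)
Lemma hessian_euler_l (U : set 'rV[R]_(n + n)) h x y w :
  Ck 1 U h -> (forall c, 0 < c -> U (row_mx x (c *: y))) ->
  (forall y', ray_homogeneous 2 h x y') ->
  \sum_(k < n) w 0 k *
     'D_(row_mx 0 y) ('D_(row_mx 0 (delta_mx 0 k)) h) (row_mx x y)
  = 'D_(row_mx 0 w) h (row_mx x y).
Proof.
move=> [dh Dh] Uxy hh.
have dxy : differentiable h (row_mx x y).
  by apply: dh; rewrite -[y]scale1r; apply: Uxy.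
rewrite derive_row_sum //; apply: eq_bigr => k _.
rewrite (@euler 1) ?mul1r // => c c0.
apply: (homogeneous_derive hh c0); last exact: diff_derivable.
exact/dh/Uxy.
Qed.

End Euler.

(** * The Finsler metric and the fundamental field *)

Section FinslerMetric.
Context (R : realType) (n : nat) (M : topologicalType) (A : atlas R n M).
Context (L : tpt A -> R).
Context (mfdM : smooth_manifold A) (finslerML : finsler L).
Implicit Types (i : aidx A) (u : tpt A) (a b : bvec A).

Definition Lsq u : R := L u ^+ 2.

Lemma chart_at u : adom (achart_at A u.1) u.1.
Proof. by case: mfdM. Qed.

Lemma Lsq_homogeneous i p y : adom i p ->
  ray_homogeneous 2 (Lsq \o slit_inv i) (achart i p) y.
Proof.
move=> ip c c0; have [Lh _ _] := finslerML.
have tw := slit_inv_tangent mfdM y ip.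
set w := slit_inv i (row_mx (achart i p) y) in tw *.
have ew : w = (p, w.2) by rewrite /w /slit_inv /= row_mxKl chartK.
suff : slit_inv i (row_mx (achart i p) (c *: y)) = (p, c *: w.2).
  by move=> E; rewrite /= E -/w [w in RHS]ew /Lsq Lh -?ew // exprMn.
have iw : w.2 i = y by exact: slit_inv_comp.
have tcw : tangent A (p, c *: w.2) by apply: tangentZ; rewrite // -ew.
have := slit_invK mfdM tcw ip.
by rewrite /tcoord /= -[(c *: w.2) i]/(c *: w.2 i) iw.
Qed.

Lemma Lsq_Ck k i : Ck k (slit_dom i) (Lsq \o slit_inv i).
Proof.
have [_ Ls _] := finslerML; have /smooth_onP/(_ k) CL := Ls i.
have oU := @open_slit_dom _ _ _ _ mfdM i.
rewrite (_ : _ \o _ = (L \o slit_inv i) * (L \o slit_inv i)); first exact: CkM.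
by apply/funext => z; rewrite /= /Lsq expr2.
Qed.

Lemma slit_ray i u (c : R) : slit u -> adom i u.1 -> 0 < c ->
  slit_dom i (row_mx (achart i u.1) (c *: u.2 i)).
Proof.
move=> su iu c0; apply/(slit_domP mfdM); exists u.1, (c *: u.2 i); split=> //.
rewrite scaler_eq0 (gt_eqF c0) /=; apply/eqP => ui.
by case: su => tu; apply; exact: tangent_eq0 ui.
Qed.

Lemma gmet_chart u a b (i := achart_at A u.1) : slit u ->
  gmet L u a b = 2^-1 * \sum_(k < n) b i 0 k *
    'D_(row_mx 0 (a i)) ('D_(row_mx 0 (delta_mx 0 k)) (Lsq \o slit_inv i))
      (tcoord i u).
Proof.
move=> su; have iu := chart_at u; rewrite -/i in iu.
rewrite /gmet -/i exchange_big mulr_sumr; apply: eq_bigr => k _.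
have [_ D2] := @Lsq_Ck 1 i.
rewrite derive_row_sum; last first.
  have [dk _] := D2 (row_mx 0 (delta_mx 0 k)).
  by apply: dk; exact: slit_dom_coord.
rewrite !mulr_sumr; apply: eq_bigr => j _.
by rewrite /gcomp -[tcoord i u]/(achart (a := slit_atlas A) i u) /=; ring.
Qed.

(** The right-hand side makes sense in every chart [i], while [gmet] uses only
    the selected one. *)
Lemma gmet_etar i u a : slit u -> tangent A (u.1, a) -> adom i u.1 ->
  gmet L u a u.2
  = 2^-1 * 'D_(row_mx 0 (a i)) (Lsq \o slit_inv i) (tcoord i u).
Proof.
move=> su ta iu; have ju := chart_at u.
rewrite gmet_chart //.
rewrite [X in _ = _ * X](derive_vert_chart mfdM Lsq su ta iu ju).
congr (_ * _).
apply: (@hessian_euler_r _ _ (slit_dom (achart_at A u.1))).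
- exact: open_slit_dom.
- exact: Lsq_Ck.
- exact: slit_dom_coord.
move=> z /(slit_domP mfdM)[p [y [jp y0 ->]]].
by rewrite row_mxKl row_mxKr; apply: Lsq_homogeneous.
Qed.

Lemma gmet_etal i u a : slit u -> tangent A (u.1, a) -> adom i u.1 ->
  gmet L u u.2 a
  = 2^-1 * 'D_(row_mx 0 (a i)) (Lsq \o slit_inv i) (tcoord i u).
Proof.
move=> su ta iu; have ju := chart_at u.
rewrite gmet_chart //.
rewrite [X in _ = _ * X](derive_vert_chart mfdM Lsq su ta iu ju).
congr (_ * _).
apply: (@hessian_euler_l _ _ (slit_dom (achart_at A u.1))).
- exact: Lsq_Ck.
- by move=> c c0; apply: slit_ray.
by move=> y; apply: Lsq_homogeneous.
Qed.

Lemma gmet_etaC u a : slit u -> tangent A (u.1, a) ->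
  gmet L u u.2 a = gmet L u a u.2.
Proof.
move=> su ta; have iu := chart_at u.
by rewrite (gmet_etal su ta iu) (gmet_etar su ta iu).
Qed.

(** Euler's theorem once more, for [L ^+ 2] itself: half of twice [L ^+ 2]. *)
Lemma gmet_eta u : slit u -> gmet L u u.2 u.2 = L u ^+ 2.
Proof.
move=> su; have [tu _] := su; have iu := chart_at u.
have tu' : tangent A (u.1, u.2) by case: (u) tu.
rewrite (gmet_etar su tu' iu) (euler (m := 2)); last exact: Lsq_homogeneous.
rewrite -/(tcoord (achart_at A u.1) u) /= slit_invK // /Lsq mulrA.
by rewrite mulVf ?mul1r.
Qed.

(** [L ^+ 2 = g(eta, eta)] is positive, as [eta] does not vanish. *)
Lemma L_neq0 u : slit u -> L u != 0.
Proof.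
move=> su; have [[tu u0] [_ _ pos]] := (su, finslerML).
have tu' : tangent A (u.1, u.2) by case: (u) tu.
have := pos u u.2 su tu' u0; rewrite gmet_eta // => L2.
by apply: contraTneq L2 => ->; rewrite expr0n ltxx.
Qed.

Lemma gmet_subZl u a b c (t : R) :
  gmet L u (a - t *: b) c = gmet L u a c - t * gmet L u b c.
Proof.
rewrite /gmet mulr_sumr -sumrB; apply: eq_bigr => j _.
rewrite mulr_sumr -sumrB; apply: eq_bigr => k _.
rewrite -[(a - t *: b) _]/(a _ - t *: b _) !mxE; ring.
Qed.

Lemma gmet_subZr u a b c (t : R) :
  gmet L u c (a - t *: b) = gmet L u c a - t * gmet L u c b.
Proof.
rewrite /gmet mulr_sumr -sumrB; apply: eq_bigr => j _.
rewrite mulr_sumr -sumrB; apply: eq_bigr => k _.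
rewrite -[(a - t *: b) _]/(a _ - t *: b _) !mxE; ring.
Qed.

(** The function [c] below is the coefficient of [eta] in the chart [i], where
    [g(X, eta)] is expanded as half the sum of the [X_j D_j (L ^+ 2)]. *)
Lemma phi_pifield X : pifield X -> pifield (phi L X).
Proof.
move=> [tX CX]; split=> [u su|i].
  rewrite /phi -scaleNr addrC; apply: tangent_comb (tX u su) => //.
  by case: su; case: u.
have oU := @open_slit_dom _ _ _ _ mfdM i.
have [_ Ls _] := finslerML.
have [_ /(_ i) Ceta] := eta_pifield mfdM.
apply/smooth_onP => k.
pose s := @slit_inv R n M A i.
pose Xi z := X (s z) i.
pose dL (j : 'I_n) := 'D_(row_mx 0 (delta_mx 0 j)) (Lsq \o s).
pose Linv z := (L (s z))^-1.
have CXi : Ck k (slit_dom i) Xi by move: CX => /(_ i) /smooth_onP.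
have CL : Ck k (slit_dom i) Linv.
  apply: CkV => //; last by have /smooth_onP := Ls i.
  by move=> z /(slit_inv_slit mfdM)[sz _ _]; apply: L_neq0.
pose c : 'rV[R]_(n + n) -> R :=
  - (Linv * Linv * (cst 2^-1 * \sum_(j < n) (fun z => Xi z 0 j) * dL j)).
have Cc : Ck k (slit_dom i) c.
  apply: CkN => //; apply: CkM => //; first exact: CkM.
  apply: CkM => //; first exact: Ck_cst.
  apply: Ck_sum => // j; apply: CkM => //; first exact: Ck_coord.
  by have [_] := @Lsq_Ck k.+1 i; apply.
apply: (@eq_Ck _ _ k _ _ (Xi + (fun z => c z *: eta (s z) i))) => // [z Uz|].
  have [su iu zE] := slit_inv_slit mfdM Uz.
  rewrite -/s in su iu zE; set u := s z in su iu zE *.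
  rewrite /phi -[RHS]/(X u i - _ *: eta u i) -scaleNr.
  rewrite -[LHS]/(X u i + _ *: eta u i); congr (_ + _ *: _).
  rewrite /ell /gf (gmet_etar su (tX u su) iu) zE derive_row_sum.
    by rewrite /c /Linv !fctE fct_sumE -/u -!mulrA.
  by have [d _] := @Lsq_Ck 0 i; exact: d.
apply: CkD => //; apply: CkZ => //; move: Ceta => /smooth_onP; exact.
Qed.

Lemma gf_phi_eta X u : slit u -> gf L (phi L X) (@eta R n M A) u = 0.
Proof.
move=> su; have L0 := L_neq0 su.
rewrite /gf /phi gmet_subZl gmet_eta // /ell /gf; field.
exact: L0.
Qed.

Lemma gf_eta_phi X u : pifield X -> slit u ->
  gf L (@eta R n M A) (phi L X) u = 0.
Proof.
move=> pX su; rewrite -(gf_phi_eta X su) /gf /eta gmet_etaC //.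
by have [tp _] := phi_pifield pX; exact: tp.
Qed.

Lemma ell_phi X u : slit u -> ell L (phi L X) u = 0.
Proof. by move=> su; rewrite /ell gf_phi_eta // mulr0. Qed.

Lemma gf_phi_phi X Y u : pifield Y -> slit u ->
  gf L (phi L X) (phi L Y) u = hbar L X Y u.
Proof.
move=> [tY _] su.
have phiX_eta : gmet L u (phi L X u) u.2 = 0 by exact: gf_phi_eta.
rewrite /gf -[phi L Y u]/(Y u - _ *: u.2) gmet_subZr phiX_eta mulr0 subr0.
rewrite -[phi L X u]/(X u - _ *: u.2) gmet_subZl gmet_etaC //; last exact: tY.
by rewrite /hbar /ell /gf /eta; ring.
Qed.

Lemma hbar_phi_phi X Y u : pifield Y -> slit u ->
  hbar L (phi L X) (phi L Y) u = hbar L X Y u.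
Proof.
by move=> pY su; rewrite {1}/hbar gf_phi_phi // ell_phi // mul0r subr0.
Qed.

End FinslerMetric.

(** * The curvature identity *)

Theorem theorem3p54 (R : realType) (n : nat) (M : topologicalType)
    (A : atlas R n M) (L : tpt A -> R) (D : connection A)
    (mfdM : smooth_manifold A) (finslerML : finsler L)
    (cartanD : cartan_connection L D) :
  R3_like L D -> scalar_curvature L D -> s_ps_curvature L D.
Proof.
move=> [_ R3] sc; split=> //; have [_ [k hk]] := sc.
pose e := @eta R n M A; have pe : pifield e := eta_pifield mfdM.
exists (fun u => 2 * (k u - Ften L D e e u / L u ^+ 2)).
have phiP X := @phi_pifield _ _ _ _ _ mfdM finslerML X.
have Fphi X Y u : pifield X -> pifield Y -> slit u ->
    Ften L D (phi L X) (phi L Y) u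
    = (k u - Ften L D e e u / L u ^+ 2) * hbar L X Y u.
  move=> pX pY su; have L0 := L_neq0 mfdM finslerML su.
  have := hk _ _ u (phiP X pX) (phiP Y pY) su.
  rewrite R3 //; [|exact: phiP..].
  rewrite hbar_phi_phi // gf_phi_phi // gf_phi_eta // gf_eta_phi //.
  rewrite [gf L _ _ u](_ : _ = L u ^+ 2); last exact: gmet_eta.
  rewrite !mul0r subr0 subr0 => H.
  have E : L u ^+ 2 * Ften L D (phi L X) (phi L Y) u
      = (k u * L u ^+ 2 - Ften L D e e u) * hbar L X Y u.
    by rewrite mulrBl -H; ring.
  apply: (mulfI (expf_neq0 2 L0)); rewrite E; field.
  exact: L0.
move=> X Y Z W u pX pY pZ pW su.
by rewrite R3 ?gf_phi_phi ?Fphi //; [ring|exact: phiP..].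
Qed.
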